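(* Let $q=p^m$ be a prime power and let $\mathbb{F}_q$ be the finite field with $q$ elements. Let $A,B\subset\mathbb{F}_q$ be arbitrary subsets with $|A||B|>q$. Then $16AB=\mathbb{F}_q$.
   Context: For $X,Y\subset\mathbb{F}_q$, $XY=\{xy: x\in X, y\in Y\}$, and for a natural number $k$, $kX=\{x_1+\dots+x_k: x_1,\dots,x_k\in X\}$; thus $16AB$ is the set of all sums of $16$ elements of $AB$. *)

(* Defs.v *)
From HB Require Import structures.
From mathcomp Require Import all_boot all_order all_algebra all_field.

Set Implicit Arguments.
Unset Strict Implicit.
Unset Printing Implicit Defensive.

Import GRing.Theory.
Local Open Scope ring_scope.

Definition prodset (F : finFieldType) (X Y : {set F}) : {set F} :=
  [set x * y | x in X, y in Y].

(* k-fold sumset { x_1 + ... + x_k : x_1, ..., x_k in X }; the summands may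
   repeat, and this is not the dilate of X by k. *)
Definition sumset (F : finFieldType) (k : nat) (X : {set F}) : {set F} :=
  [set \sum_(i < k) f i | f : {ffun 'I_k -> F} in ffun_on X].

(* Main.v *)
Require Import Defs.
From HB Require Import structures.
From mathcomp Require Import all_boot all_order all_algebra all_field.
From mathcomp Require Import ring.

Set Implicit Arguments.
Unset Strict Implicit.
Unset Printing Implicit Defensive.

Import GRing.Theory.
Local Open Scope ring_scope.

(** Averaging the additive energy of [A] and [c B] over all [c] in the field
    produces a [c] for which the energy is so small that both [A + c B] and
    [A - c B] have more than [q/2] elements.  By pigeonhole [A + c B + A + c B]
    is then the whole field, and in particular it contains [- (a + c b)] for
    all [a], [b].  Since [|A||B| > q], two distinct pairs give the same [a + c b],
    and one of them yields a relation
    [(a1 + a2 + a3) + c (b1 + b2 + b3) = 0] with [s = b1 + b2 + b3 <> 0].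
    Hence [s (A - c B) = s A + (a1 + a2 + a3) B] lies in [6AB] and has more than
    [q/2] elements, so [12AB] is already the whole field. *)

(** Cauchy-Schwarz for the fibre sizes [r u]: they sum to [#|D|], and their squares sum to the
    number of colliding pairs. *)
Lemma card_collisions (T U : finType) (f : T -> U) (D : {set T}) :
  (#|D| ^ 2 <= #|f @: D| *
     #|[set w in setX D D | f w.1 == f w.2]|)%N.
Proof.
set r := fun u => #|[set x in D | f x == u]|.
have rE u : r u = (\sum_(x in D) (f x == u))%N.
  rewrite /r -sum1_card (eq_bigl (fun x => (x \in D) && (f x == u))); last first.
    by move=> x; rewrite inE.
  by rewrite big_mkcondr; apply: eq_bigr => x _; case: eqP.
have sumr : #|D| = (\sum_(u in f @: D) r u)%N.
  rewrite -sum1_card (partition_big_imset f); apply: eq_bigr => u _.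
  by rewrite /r -sum1_card; apply: eq_bigl => x; rewrite inE.
have sumr2 : #|[set w in setX D D | f w.1 == f w.2]|
             = (\sum_(u in f @: D) r u ^ 2)%N.
  rewrite -sum1_card.
  rewrite (eq_bigl (fun w => ((w.1 \in D) && (w.2 \in D)) && (f w.1 == f w.2)));
    last by move=> [x y]; rewrite !inE.
  rewrite big_mkcondr -(pair_big (mem D) (mem D)
    (fun x y => if f x == f y then 1 else 0)%N) /= (partition_big_imset f) /=.
  apply: eq_bigr => u _; rewrite expnS expn1 {1}/r -sum1_card big_distrl /=.
  apply: eq_big => [x|x /andP[_ /eqP <-]]; first by rewrite !inE.
  by rewrite mul1n rE; apply: eq_bigr => y _; rewrite eq_sym; case: eqP.
(* Doubling both sides lets [2 * (r u * r v) <= r u ^ 2 + r v ^ 2] be summed over all pairs [u],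
   [v]. *)
rewrite sumr2 {1}sumr -(leq_pmul2l (ltn0Sn 1)).
have -> : (2 * (\sum_(u in f @: D) r u) ^ 2 =
  \sum_(u in f @: D) \sum_(v in f @: D) 2 * (r u * r v))%N.
  rewrite expnS expn1 big_distrl big_distrr; apply: eq_bigr => u _ /=.
  by rewrite big_distrr big_distrr.
apply: (@leq_trans (\sum_(u in f @: D) \sum_(v in f @: D)
                      (r u ^ 2 + r v ^ 2))%N).
  by apply: leq_sum => u _; apply: leq_sum => v _; apply: nat_Cauchy.
under eq_bigr do rewrite big_split /= sum_nat_const.
by rewrite big_split /= sum_nat_const -big_distrr /= addnn mul2n.
Qed.

(** The sets [X] and [z - Y] are together too large to be disjoint. *)
Lemma exists_sum_of_card (F : finZmodType) (X Y : {set F}) (z : F) :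
  (#|F| < #|X| + #|Y|)%N -> exists x y, [/\ x \in X, y \in Y & z = x + y].
Proof.
move=> cXY; pose Z := [set z - y | y in Y].
have cZ : #|Z| = #|Y| by rewrite card_imset // => u v /addrI /oppr_inj.
have : (0 < #|X :&: Z|)%N.
  rewrite -(ltn_add2l #|X :|: Z|) addn0 cardsUI cZ.
  exact: leq_ltn_trans (max_card _) cXY.
case/card_gt0P=> x /setIP[xX /imsetP[y yY xE]].
by exists x, y; split=> //; rewrite xE subrK.
Qed.

Definition lin_form (F : finFieldType) (c : F) (w : F * F) : F := w.1 + c * w.2.

(** Counting over pairs in [A * B] rather than over elements of [c B] keeps the definition uniform
    in [c], including [c = 0]. *)
Definition energy (F : finFieldType) (A B : {set F}) (c : F) : nat :=
  #|[set w in setX (setX A B) (setX A B) | lin_form c w.1 == lin_form c w.2]|.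

(** Two different slopes [c] solving [a + c b = a' + c b'] force [b = b'], hence [a = a']; only
    equal points collide for more than one slope. *)
Lemma card_collision_slopes (F : finFieldType) (w : (F * F) * (F * F)) :
  (#|[set c | lin_form c w.1 == lin_form c w.2]|
     <= #|F| * (w.1 == w.2) + 1)%N.
Proof.
case: w => [[a b] [a' b']] /=; rewrite /lin_form /=.
have [_|neq] := eqVneq; first by rewrite muln1 (leq_trans (max_card _)) ?leq_addr.
rewrite muln0 add0n; apply/card_le1P => c; rewrite inE => /eqP ec c'.
rewrite !inE; apply/eqP/eqP => [ec'|->//].
have eqM : (c' - c) * (b - b') = 0.
  have -> : (c' - c) * (b - b') =
    (a + c' * b - (a' + c' * b')) - (a + c * b - (a' + c * b')).
    by ring.
  by rewrite ec ec' !subrr.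
move/eqP: eqM; rewrite mulf_eq0 !subr_eq0 => /orP[/eqP //|/eqP bb'].
by case/eqP: neq; move: ec; rewrite bb' => /addIr ->.
Qed.

(** Double counting: after exchanging the sums, the diagonal gives the first term and one slope per
    pair of points gives the second. *)
Lemma sum_energy (F : finFieldType) (A B : {set F}) :
  (\sum_c energy A B c
     <= #|F| * (#|A| * #|B|) + (#|A| * #|B|) ^ 2)%N.
Proof.
set D := setX A B.
have -> : (\sum_c energy A B c = \sum_(w in setX D D)
    #|[set c | lin_form c w.1 == lin_form c w.2]|)%N.
  rewrite /energy.
  under eq_bigr do rewrite -sum1_card big_mkcond /=.
  under [RHS]eq_bigr do rewrite -sum1_card big_mkcond /=.
  rewrite exchange_big /= [RHS]big_mkcond; apply: eq_bigr => w _.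
  case: ifP => wD; last by rewrite big1 // => c _; rewrite inE wD.
  by apply: eq_bigr => c _; rewrite inE wD inE.
apply: (@leq_trans (\sum_(w in setX D D) (#|F| * (w.1 == w.2) + 1))%N).
  by apply: leq_sum => w _; apply: card_collision_slopes.
rewrite big_split /= sum1_card !cardsX -big_distrr /= leq_add //.
rewrite leq_mul2l; apply/orP; right.
rewrite (eq_bigl (fun w => (w.1 \in D) && (w.2 \in D))); last first.
  by case=> u v; rewrite in_setX.
rewrite -(pair_big (mem D) (mem D) (fun u v => (u == v : nat))) /=.
rewrite -cardsX -sum1_card; apply: leq_sum => u uD.
rewrite (bigD1 u) //= eqxx big1 // => v /andP[_].
by rewrite eq_sym => /negPf ->.
Qed.

(** Exchanging [b] and [b'] turns [a - c b = a' - c b'] into [a + c b' = a' + c b]. Thus one slope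
    serves for both signs. *)
Lemma energyN (F : finFieldType) (A B : {set F}) (c : F) :
  (energy A B (- c) <= energy A B c)%N.
Proof.
pose h (w : (F * F) * (F * F)) := ((w.1.1, w.2.2), (w.2.1, w.1.2)).
have h_inj : injective h.
  by move=> [[? ?] [? ?]] [[? ?] [? ?]] [-> -> -> ->].
rewrite /energy -(card_imset _ h_inj); apply/subset_leq_card/subsetP => w.
case/imsetP=> -[[a b] [a' b']] + ->; rewrite !inE /lin_form /=.
case/andP=> /andP[/andP[-> ->] /andP[-> ->]] /eqP e; apply/eqP.
rewrite (_ : a + c * b' = a + - c * b + c * (b + b')); last by ring.
by rewrite e; ring.
Qed.

(** With [N = |A||B|], an image of at most [q/2] elements would give [2 N^2 <= q E <= q N + N^2], so
    [N <= q]. *)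
Lemma large_of_small_energy (F : finFieldType) (A B : {set F}) (c : F) :
  (#|F| < #|A| * #|B|)%N ->
  (#|F| * energy A B c <= #|F| * (#|A| * #|B|) + (#|A| * #|B|) ^ 2)%N ->
  (#|F| < 2 * #|lin_form c @: setX A B|)%N.
Proof.
move=> hAB hE; rewrite ltnNge; apply/negP => hX.
have := card_collisions (lin_form c) (setX A B).
rewrite -/(energy A B c) cardsX -(leq_pmul2l (ltn0Sn 1)) mulnA => h.
have := leq_trans (leq_trans h (leq_mul hX (leqnn _))) hE.
rewrite mul2n -addnn leq_add2r -mulnn leq_pmul2r; last first.
  exact: leq_ltn_trans (leq0n _) hAB.
by rewrite leqNgt hAB.
Qed.

Lemma exists_large_dilates (F : finFieldType) (A B : {set F}) :
  (#|F| < #|A| * #|B|)%N ->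
  exists c, (#|F| < 2 * #|lin_form c @: setX A B|)%N /\
            (#|F| < 2 * #|lin_form (- c) @: setX A B|)%N.
Proof.
move=> hAB.
set M := (#|F| * (#|A| * #|B|) + (#|A| * #|B|) ^ 2)%N.
(* [M] bounds the sum of the energies over all [#|F|] slopes, so some slope is at most average. *)
have [c hc] : exists c, (#|F| * energy A B c <= M)%N.
  apply/existsP; rewrite -[[exists _, _]]negbK negb_exists.
  apply/negP => /forallP hall.
  have : (\sum_(c : F) M.+1 <= \sum_c #|F| * energy A B c)%N.
    by apply: leq_sum => c _; rewrite ltnNge; apply: hall.
  rewrite sum_nat_const -big_distrr /= leq_pmul2l; last first.
    by apply/card_gt0P; exists 0.
  by rewrite ltnNge sum_energy.
exists c; split; apply: large_of_small_energy => //.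
by apply: leq_trans hc; rewrite leq_mul2l energyN orbT.
Qed.

Lemma sumset1 (F : finFieldType) (X : {set F}) (x : F) :
  x \in X -> x \in sumset 1 X.
Proof.
move=> xX; apply/imsetP; exists [ffun=> x]; last by rewrite big_ord1 ffunE.
by apply/ffun_onP => i; rewrite ffunE.
Qed.

Lemma sumsetD (F : finFieldType) (m n : nat) (X : {set F}) (x y : F) :
  x \in sumset m X -> y \in sumset n X -> x + y \in sumset (m + n) X.
Proof.
case/imsetP=> f /ffun_onP fX -> /imsetP[g /ffun_onP gX ->].
apply/imsetP.
exists [ffun i => match split i with inl j => f j | inr j => g j end].
  by apply/ffun_onP => i; rewrite ffunE; case: split.
rewrite big_split_ord /=; congr (_ + _); apply: eq_bigr => i _; rewrite ffunE.
  by rewrite -[lshift _ _]/(unsplit (inl i)) unsplitK.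
by rewrite -[rshift _ _]/(unsplit (inr i)) unsplitK.
Qed.

Lemma exists_relation (F : finFieldType) (A B : {set F}) (c : F) :
  (#|F| < #|A| * #|B|)%N ->
  (#|F| < 2 * #|lin_form c @: setX A B|)%N ->
  exists (a1 a2 a3 b1 b2 b3 : F),
  [/\ [/\ a1 \in A, a2 \in A & a3 \in A], [/\ b1 \in B, b2 \in B & b3 \in B],
      b1 + b2 + b3 != 0 & a1 + a2 + a3 = - c * (b1 + b2 + b3)].
Proof.
move=> hAB; rewrite mul2n -addnn => hX.
have /dinjectivePn : ~~ dinjectiveb (lin_form c) (mem (setX A B)).
  apply/negP => /dinjectiveP inj; move: hAB.
  by rewrite -cardsX -(card_in_imset inj) ltnNge max_card.
case=> -[a b] /setXP[aA bB] [[a' b']].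
rewrite !inE /= => /andP[neq /andP[a'A b'B]]; rewrite /lin_form /= => eqab.
have [x [y [/imsetP[[a1 b1] /setXP[a1A b1B] ->]]]] :=
  exists_sum_of_card (- (a + c * b)) hX.
case/imsetP=> -[a2 b2] /setXP[a2A b2B] ->; rewrite /lin_form /= => e.
have rel a3 b3 : a3 + c * b3 = a + c * b ->
    a1 + a2 + a3 = - c * (b1 + b2 + b3).
  move=> e3; apply/eqP; rewrite -subr_eq0; apply/eqP.
  transitivity (a1 + c * b1 + (a2 + c * b2) + (a3 + c * b3)); first by ring.
  by rewrite -e e3 addNr.
(* Either colliding pair can serve as the third one. The sum of the [b]'s cannot vanish for both,
   since [b = b'] would force [a = a']. *)
have [s0|s_neq0] := eqVneq (b1 + b2 + b) 0.
  exists a1, a2, a', b1, b2, b'; split=> //; last exact: rel.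
  apply: contraNneq neq => s0'.
  have bE : b = b' by apply: (@addrI _ (b1 + b2)); rewrite s0 s0'.
  by move: eqab; rewrite bE => /addIr ->.
by exists a1, a2, a, b1, b2, b; split=> //; apply: rel.
Qed.

Lemma mem_sumset12_prodset (F : finFieldType) (A B : {set F}) (z : F) :
  (#|F| < #|A| * #|B|)%N -> z \in sumset 12 (prodset A B).
Proof.
move=> hAB; have [c [hc hNc]] := exists_large_dilates hAB.
have [a1 [a2 [a3 [b1 [b2 [b3 [[a1A a2A a3A] [b1B b2B b3B] s0 tE]]]]]]] :=
  exists_relation hAB hc.
have AB a b : a \in A -> b \in B -> a * b \in sumset 1 (prodset A B).
  by move=> aA bB; apply/sumset1/imset2P; exists a b.
set s := b1 + b2 + b3 in s0 tE.
have scaled x : x \in lin_form (- c) @: setX A B -> s * x \in sumset 6 (prodset A B).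
  case/imsetP=> -[a b] /setXP[aA bB] ->.
  (* As [- c * s = a1 + a2 + a3], the element [s * (a - c b)] equals
     [a * (b1 + b2 + b3) + (a1 + a2 + a3) * b], a sum of six products. *)
  rewrite /lin_form /= mulrDr mulrA [s * _]mulrC [s * _]mulrC -tE.
  rewrite /s !mulrDr !mulrDl (_ : 6 = 1 + 1 + 1 + (1 + 1 + 1))%N //.
  by do ![apply: sumsetD]; apply: AB.
move: hNc; rewrite mul2n -addnn => /(exists_sum_of_card (z / s)).
case=> x [y [/scaled xS /scaled yS zE]].
by rewrite -[z](divfK s0) mulrC zE mulrDr; apply: (@sumsetD _ 6 6).
Qed.

Theorem theorem9 (p m q : nat) (p_prime : prime p) (m_gt0 : (0 < m)%N)
    (q_def : q = (p ^ m)%N) (F : finFieldType) (cardF : #|F| = q)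
    (A B : {set F}) (hAB : (q < #|A| * #|B|)%N) :
  sumset 16 (prodset A B) = [set: F].
Proof.
rewrite -cardF in hAB.
have := leq_ltn_trans (leq0n _) hAB; rewrite muln_gt0.
case/andP=> /card_gt0P[a aA] /card_gt0P[b bB].
have ab1 : a * b \in sumset 1 (prodset A B).
  by apply/sumset1/imset2P; exists a b.
(* Four copies of one fixed product pad twelve summands to sixteen: the twelve represent [z] minus
   these copies. *)
have ab4 := sumsetD (sumsetD ab1 ab1) (sumsetD ab1 ab1).
apply/setP => z; rewrite in_setT -[z](subrK (a * b + a * b + (a * b + a * b))).
exact: (@sumsetD _ 12 4) (mem_sumset12_prodset _ hAB) ab4.
Qed.
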